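(* Let $G$ be a simple, simply-connected linear algebraic group over $\mathbb{C}$ of rank $r$, and let $j\in\{1,\dots,r\}$. The vertices of $IP_{\varpi_j}$ consist of the following: (a) $\varpi_j$; and (b) $\varpi_j-\sum_{i\in I}c_i\alpha_i$, where $I$ ranges over the connected subdiagrams of the Dynkin diagram of $G$ containing node $j$, and the coefficients $(c_i)_{i\in I}$ are the entries of the column indexed by $j$ of the inverse transpose of the Cartan matrix associated to $I$.
   Context: Fix a maximal torus and Borel subgroup $T\subset B\subset G$; let $\alpha_1,\dots,\alpha_r$ be the simple roots, $\alpha_1^\vee,\dots,\alpha_r^\vee$ the simple coroots, $\varpi_1,\dots,\varpi_r$ the fundamental weights, and $W$ the Weyl group. For a dominant weight $\lambda$, the intersection polytope $IP_\lambda$ is the intersection of the Weyl polytope $\mathrm{conv}(W\cdot\lambda)\subset X^*(T)\otimes\mathbb{Q}$ with the rational dominant cone $\{\mu : \langle\mu,\alpha_i^\vee\rangle\ge 0\ \forall i\}$. A subdiagram is identified with its set of nodes $I\subseteq\{1,\dots,r\}$ (full subdiagram on these nodes). The Cartan matrix associated to $I$ is $C_I=(\langle\alpha_i,\alpha_k^\vee\rangle)_{i,k\in I}$ (row index $i$, column index $k$); thus the $c_i$ are the rational numbers with $\sum_{i\in I}c_i\langle\alpha_i,\alpha_k^\vee\rangle=\delta_{jk}$ for all $k\in I$. *)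

(* Defs.v *)
From mathcomp Require Import all_boot all_order all_algebra.
Set Implicit Arguments.
Unset Strict Implicit.
Unset Printing Implicit Defensive.
Import Order.TTheory GRing.Theory Num.Theory.
Local Open Scope ring_scope.

(* Characters and cocharacters of a torus of rank n are written in dual
   Z-bases, so that X^*(T) = X_*(T) = Z^n and the perfect pairing between them
   is the dot product.  The same formula extends it to X^*(T) (x) Q. *)
Definition pairing (R : comNzRingType) (n : nat) (x y : 'rV[R]_n) : R :=
  (x *m y^T) 0 0.

Definition toQ (n : nat) (x : 'rV[int]_n) : 'rV[rat]_n := map_mx intr x.

(* A pair (G, T), with G a connected reductive group over C and T a maximal
   torus, is represented by its (reduced) root datum, which determines it up to
   isomorphism; every reduced root datum arises in this way.  The values of
   [coroot] outside [roots] are irrelevant. *)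
Record root_datum (n : nat) := RootDatum {
  roots : seq 'rV[int]_n;
  coroot : 'rV[int]_n -> 'rV[int]_n;
  coroot_inj : {in roots &, injective coroot};
  root_coroot2 : forall a, a \in roots -> pairing a (coroot a) = 2;
  refl_root : forall a b, a \in roots -> b \in roots ->
    b - pairing b (coroot a) *: a \in roots;
  refl_coroot : forall a b, a \in roots -> b \in roots ->
    coroot b - pairing a (coroot b) *: coroot a \in [seq coroot c | c <- roots];
  roots_reduced : forall a, a \in roots -> 2 *: a \notin roots
}.

Section RootDatum.
Variables (n : nat) (D : root_datum n).

Definition semisimple : Prop :=
  forall x : 'rV[rat]_n, exists c : 'I_(size (roots D)) -> rat,
    x = \sum_k c k *: toQ (roots D)`_k.

Definition irreducible_roots : Prop :=
  roots D != [::] /\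
  forall P : pred 'rV[int]_n,
    (forall a b, a \in roots D -> b \in roots D -> P a -> ~~ P b ->
       pairing a (coroot D b) = 0) ->
    {in roots D, forall a, P a} \/ {in roots D, forall a, ~~ P a}.

(* "Simple" in the sense of algebraic groups: nonabelian, with no nontrivial
   proper closed connected normal subgroup; finite centers are allowed. *)
Definition simple_datum : Prop := semisimple /\ irreducible_roots.

(* X_*(T) is the coroot lattice. *)
Definition simply_connected : Prop :=
  forall y : 'rV[int]_n, exists c : 'I_(size (roots D)) -> int,
    y = \sum_k c k *: coroot D (roots D)`_k.

(* Borel subgroups containing T correspond to bases of the root system.  For
   semisimple D a base has n elements, whence the index type. *)
Definition is_base (alpha : 'I_n -> 'rV[int]_n) : Prop :=
  [/\ forall i, alpha i \in roots D,
      forall c : 'I_n -> int, \sum_i c i *: alpha i = 0 -> forall i, c i = 0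
    & forall a, a \in roots D -> exists c : 'I_n -> nat,
        a = \sum_i alpha i *+ c i \/ a = - \sum_i alpha i *+ c i].

Definition is_fundamental_weights (alpha varpi : 'I_n -> 'rV[int]_n) : Prop :=
  forall i k, pairing (varpi i) (coroot D (alpha k)) = (i == k)%:R.

Definition reflection (a : 'rV[int]_n) (mu : 'rV[rat]_n) : 'rV[rat]_n :=
  mu - pairing mu (toQ (coroot D a)) *: toQ a.

(* Elements of W are products of reflections, which are involutions. *)
Definition weyl_orbit (lam mu : 'rV[rat]_n) : Prop :=
  exists2 s : seq 'rV[int]_n, {subset s <= roots D} & mu = foldr reflection lam s.

Definition dominant (alpha : 'I_n -> 'rV[int]_n) (mu : 'rV[rat]_n) : Prop :=
  forall i, 0 <= pairing mu (toQ (coroot D (alpha i))).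

Definition cartan (alpha : 'I_n -> 'rV[int]_n) : 'M[rat]_n :=
  \matrix_(i, k) pairing (toQ (alpha i)) (toQ (coroot D (alpha k))).

End RootDatum.

Definition conv_hull (n : nat) (S : 'rV[rat]_n -> Prop) (x : 'rV[rat]_n) : Prop :=
  exists (m : nat) (p : 'I_m -> 'rV[rat]_n) (t : 'I_m -> rat),
    [/\ forall k, S (p k), forall k, 0 <= t k, \sum_k t k = 1
      & x = \sum_k t k *: p k].

Definition vertex (n : nat) (P : 'rV[rat]_n -> Prop) (v : 'rV[rat]_n) : Prop :=
  P v /\ forall (x y : 'rV[rat]_n) (t : rat), P x -> P y -> 0 < t < 1 ->
    v = t *: x + (1 - t) *: y -> x = v /\ y = v.

Definition intersection_polytope (n : nat) (D : root_datum n)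
    (alpha : 'I_n -> 'rV[int]_n) (lam mu : 'rV[rat]_n) : Prop :=
  conv_hull (weyl_orbit D lam) mu /\ dominant D alpha mu.

Section Dynkin.
Variables (n : nat) (D : root_datum n) (alpha : 'I_n -> 'rV[int]_n).

Definition dynkin_edge : rel 'I_n :=
  fun i k => (i != k) && (cartan D alpha i k != 0).

Definition connected_subdiagram (I : {set 'I_n}) : bool :=
  (I != set0) &&
  [forall i in I, forall k in I,
     connect [rel x y | [&& x \in I, y \in I & dynkin_edge x y]] i k].

(* Rows and columns are indexed through the enumeration of I. *)
Definition sub_cartan (I : {set 'I_n}) : 'M[rat]_#|I| :=
  mxsub enum_val enum_val (cartan D alpha).

(* \sum_(i in I) c_i alpha_i, with c the column of index j of the inverse
   transpose of sub_cartan I. *)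
Definition subdiagram_sum (I : {set 'I_n}) (j : 'I_n) (jI : j \in I) :
    'rV[rat]_n :=
  \sum_(a < #|I|)
    invmx (sub_cartan I)^T a (enum_rank_in jI j) *: toQ (alpha (enum_val a)).

End Dynkin.

(* Main.v *)
Require Import Defs.
From mathcomp Require Import all_boot all_order all_algebra all_fingroup.
From mathcomp Require Import ring lra zify.
(* [fingraph.roots] would otherwise shadow the field [roots]. *)
Import Defs.
Set Implicit Arguments.
Unset Strict Implicit.
Unset Printing Implicit Defensive.
Import Order.TTheory GRing.Theory Num.Theory.
Local Open Scope ring_scope.

(* Write a point as [varpi_j - \sum_i c_i alpha_i].  Every Weyl conjugate of
   [varpi_j] is below [varpi_j] in the dominance order (exchange condition), so
   the intersection polytope lies in the region [c >= 0, c C <= e_j], with [C]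
   the Cartan matrix.  Conversely, the corner of this region attached to a
   subdiagram [I] is the average of [varpi_j] over the parabolic subgroup [W_I],
   hence in the convex hull.  If [c] has support [J], then [J] is connected and
   contains [j] (the invariant form is definite), and every constraint tight at
   [c] is tight at the corner of [J]; pushing [c] away from that corner until a
   new constraint becomes tight shows by induction that the region is the convex
   hull of [varpi_j] and the corners, and that [c] is not extreme unless it is the
   corner itself. *)

(** * The feasible region of coefficient vectors and its corners *)

Section FeasibleRegion.

Variables (R : realFieldType) (n : nat) (C : 'M[R]_n) (d : 'I_n -> R) (j : 'I_n).
(** In the application [C] is the Cartan matrix, [d] gives half the squared lengths of the simple
    roots, and the sum is the invariant form evaluated at the vector with simple-root coordinates
    [x]. *)
Hypothesis form_definite : forall x : 'rV[R]_n,
  \sum_k d k * (x 0 k * (x *m C) 0 k) <= 0 -> x = 0.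
Hypothesis d_gt0 : forall k, 0 < d k.
Hypothesis C_offdiag : forall i k, i != k -> C i k <= 0.
Hypothesis C_zero_sym : forall i k, C i k = 0 -> C k i = 0.

Definition slack (c : 'rV[R]_n) (u : 'I_n + 'I_n) : R :=
  match u with inl i => c 0 i | inr k => (j == k)%:R - (c *m C) 0 k end.

Definition feasible (c : 'rV[R]_n) := forall u, 0 <= slack c u.

(** If [I] misses [j], definiteness forces [c = 0]; thus the empty [I] accounts for the point
    [varpi_j] itself. *)
Definition corner (I : {set 'I_n}) (c : 'rV[R]_n) :=
  (forall i, i \notin I -> c 0 i = 0) /\
  (forall k, k \in I -> (c *m C) 0 k = (j == k)%:R).

Definition rsupp (c : 'rV[R]_n) : {set 'I_n} := [set i | c 0 i != 0].

Definition loose (c : 'rV[R]_n) := [set u | slack c u != 0].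

Lemma mulC_le0 (c : 'rV[R]_n) k :
  (forall i, 0 <= c 0 i) -> c 0 k = 0 -> (c *m C) 0 k <= 0.
Proof.
move=> c_ge0 ck0; rewrite mxE; apply: sumr_le0 => i _.
have [->|ik] := eqVneq i k; first by rewrite ck0 mul0r.
by rewrite mulr_ge0_le0 // C_offdiag.
Qed.

Lemma supported_definite (I : {set 'I_n}) (x : 'rV[R]_n) :
  (forall i, i \notin I -> x 0 i = 0) ->
  (forall k, k \in I -> x 0 k * (x *m C) 0 k <= 0) -> x = 0.
Proof.
move=> xI xC; apply: form_definite; apply: sumr_le0 => k _.
have [kI|/xI->] := boolP (k \in I); last by rewrite mul0r mulr0.
by rewrite mulr_ge0_le0 ?xC // ltW.
Qed.

Lemma corner_inj (I : {set 'I_n}) (c e : 'rV[R]_n) :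
  corner I c -> corner I e -> c = e.
Proof.
move=> [c0 cC] [e0 eC]; apply/eqP; rewrite -subr_eq0; apply/eqP.
apply: (@supported_definite I) => [i iI|k kI].
  by rewrite !mxE c0 // e0 // subr0.
by rewrite mulmxBl [X in _ * X]mxE [X in _ * (_ + X)]mxE cC // eC // subrr mulr0.
Qed.

(** Split [c = p - m] into positive and negative parts. Where [c] is negative, [k] lies in [I] and
    [p] vanishes, so [(p *m C)_k <= 0 <= (c *m C)_k]. Every term of the form at [m] is then
    nonpositive, and definiteness gives [m = 0]. *)
Lemma corner_ge0 (I : {set 'I_n}) (c : 'rV[R]_n) :
  corner I c -> forall i, 0 <= c 0 i.
Proof.
move=> [c0 cC].
pose p := \row_i Num.max (c 0 i) 0; pose m := \row_i Num.max (- c 0 i) 0.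
have cE : c = p - m.
  by apply/rowP=> i; rewrite !mxE; case: leP => ?; case: leP => ?; lra.
have p_ge0 i : 0 <= p 0 i by rewrite mxE le_max lexx orbT.
have m0 : m = 0.
  apply: form_definite; apply: sumr_le0 => k _.
  apply: mulr_ge0_le0; first exact: ltW.
  have [ck|ck] := leP 0 (c 0 k).
    by rewrite [m 0 k]mxE max_r ?oppr_le0 // mul0r.
  have kI : k \in I by apply: contraTT ck => /c0 ->; rewrite ltxx.
  have mE : m = p - c by rewrite cE opprB addrC subrK.
  have mC : (m *m C) 0 k = (p *m C) 0 k - (c *m C) 0 k.
    by rewrite mE mulmxBl !mxE.
  rewrite mulr_ge0_le0 ?[m 0 k]mxE ?le_max ?lexx ?orbT // mC cC //.
  have : (p *m C) 0 k <= 0.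
    by apply: mulC_le0 => //; rewrite mxE max_r // ltW.
  have : 0 <= (j == k)%:R :> R by rewrite ler0n.
  lra.
by move=> i; rewrite cE m0 subr0.
Qed.

Lemma corner_feasible (I : {set 'I_n}) (c : 'rV[R]_n) : corner I c -> feasible c.
Proof.
move=> cI; have c_ge0 := corner_ge0 cI; case: cI => c0 cC [i|k] //=.
have [kI|/c0 ck] := boolP (k \in I); first by rewrite cC // subrr.
by rewrite subr_ge0 (le_trans (mulC_le0 c_ge0 ck)) ?ler0n.
Qed.

(** Let [x] be the restriction of [c] to [S]. No entry of [C] links the rest of the support to [S],
    so [x *m C] and [c *m C] agree on [S], where they are nonpositive because [j] is not in [S].
    Definiteness then kills [x]. *)
Lemma supp_feasible (c : 'rV[R]_n) (S : {set 'I_n}) : feasible c ->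
  S \subset rsupp c -> j \notin S ->
  (forall i k, i \in rsupp c :\: S -> k \in S -> C i k = 0) -> S = set0.
Proof.
move=> cP /subsetP Sc jS Csep.
pose x := \row_i (if i \in S then c 0 i else 0).
have c_ge0 i : 0 <= c 0 i by apply: (cP (inl i)).
have x0 : x = 0.
  apply: (@supported_definite S) => [i /negbTE iS|k kS].
    by rewrite mxE iS.
  have -> : (x *m C) 0 k = (c *m C) 0 k.
    rewrite !mxE; apply: eq_bigr => i _; rewrite mxE.
    case: ifP => // iS; have [->|ci] := eqVneq (c 0 i) 0; first by rewrite mul0r.
    by rewrite Csep ?mulr0 // !inE iS ci.
  rewrite mxE kS mulr_ge0_le0 //.
  have := cP (inr k); rewrite /= (_ : (j == k) = false) ?sub0r ?oppr_ge0 //.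
  by apply: contraNF jS => /eqP->.
apply/setP=> k; rewrite inE; apply/negP => kS.
have := congr1 (fun y : 'rV_n => y 0 k) x0; rewrite !mxE kS => /eqP.
by have := Sc _ kS; rewrite inE => /negPf->.
Qed.

Lemma rsupp_j (c : 'rV[R]_n) : feasible c -> c != 0 -> j \in rsupp c.
Proof.
move=> cP; apply: contraR => jc.
have /setP E : rsupp c = set0.
  by apply: (supp_feasible cP) => // i k; rewrite setDv inE.
by apply/eqP/rowP=> i; have := E i; rewrite !inE mxE => /negbFE/eqP.
Qed.

Lemma slackD (c e : 'rV[R]_n) (t : R) u :
  slack (c + t *: (c - e)) u = slack c u + t * (slack c u - slack e u).
Proof.
case: u => [i|k] /=; first by rewrite !mxE.
rewrite mulmxDl -scalemxAl mulmxBl.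
rewrite ![(_ + _ : 'rV_n) 0 k]mxE ![(_ *: _ : 'rV_n) 0 k]mxE.
rewrite ![(_ + _ : 'rV_n) 0 k]mxE ![(- _ : 'rV_n) 0 k]mxE; ring.
Qed.

(** The real case is [inr k] with [k] outside the support: [(c *m C)_k = 0] is a sum of nonpositive
    terms, so [C i k = 0] for all [i] in the support, which also carries [e]. *)
Lemma slack_corner0 (c e : 'rV[R]_n) u :
  feasible c -> c != 0 -> corner (rsupp c) e ->
  slack c u = 0 -> slack e u = 0.
Proof.
move=> cP cn0 [e0 eC]; have jJ := rsupp_j cP cn0.
have c_ge0 i : 0 <= c 0 i by apply: (cP (inl i)).
case: u => [i|k] /=; first by move=> ci; rewrite e0 // inE ci eqxx.
have [kJ _|kJ] := boolP (k \in rsupp c); first by rewrite eC // subrr.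
have -> : (j == k) = false by apply: contraNF kJ => /eqP<-.
have ck : c 0 k = 0 by apply/eqP; move: kJ; rewrite inE negbK.
rewrite !sub0r => /eqP; rewrite oppr_eq0 mxE => /eqP s0.
suff z i : c 0 i * C i k = 0.
  apply/eqP; rewrite oppr_eq0 mxE; apply/eqP; apply: big1 => i _.
  have [iJ|/e0->] := boolP (i \in rsupp c); last by rewrite mul0r.
  have /eqP := z i; move: iJ; rewrite mulf_eq0 inE => /negPf-> /eqP->.
  by rewrite mulr0.
have le0 i' : c 0 i' * C i' k <= 0.
  have [->|ik] := eqVneq i' k; first by rewrite ck mul0r.
  by rewrite mulr_ge0_le0 // C_offdiag.
have s0N : \sum_i' - (c 0 i' * C i' k) = 0 by rewrite sumrN s0 oppr0.
apply/eqP; rewrite -oppr_eq0; apply/eqP.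
by apply: (psumr_eq0P _ s0N) => // i' _; rewrite oppr_ge0.
Qed.

(** This makes the ray from [e] through [c] leave the region. Otherwise, on the support, [c - e]
    would be nonnegative and [(c - e) *m C] nonpositive, forcing [c = e]. *)
Lemma slack_decrease (c e : 'rV[R]_n) : c != e -> corner (rsupp c) e ->
  exists u, slack c u < slack e u.
Proof.
move=> ce [e0 eC]; apply/existsP; apply: contraNT ce => /existsPn h.
have {}h u : slack e u <= slack c u by rewrite leNgt h.
rewrite -subr_eq0; apply/eqP; apply: (@supported_definite (rsupp c)).
  by move=> i iJ; rewrite !mxE e0 // subr0; apply/eqP; move: iJ; rewrite inE negbK.
move=> k kJ; rewrite mulmxBl ![(_ - _ : 'rV_n) 0 k]mxE ![(- _ : 'rV_n) 0 k]mxE.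
have := h (inl k); have := h (inr k) => /= h1 h2.
by rewrite mulr_ge0_le0; lra.
Qed.

(* The ray from the corner through c leaves the feasible region at a point with
   strictly more tight constraints than c. *)
Lemma feasible_push (c e : 'rV[R]_n) :
  feasible c -> c != 0 -> c != e -> corner (rsupp c) e ->
  exists2 t, 0 < t & feasible (c + t *: (c - e)) /\
    (#|loose (c + t *: (c - e))%R| < #|loose c|)%N.
Proof.
move=> cP cn0 ce eJ; have [u0 u0P] := slack_decrease ce eJ.
have slack_t u := @slack_corner0 c e u cP cn0 eJ.
have eP := corner_feasible eJ.
(* [F u] is the time at which the ray reaches the wall [u]; its minimum over the constraints that
   decrease along the ray is the exit time. *)
pose F u := slack c u / (slack e u - slack c u).
have [u uP umin] := @Order.TotalTheory.arg_minP _ R _ u0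
  (fun u => slack c u < slack e u) F u0P.
have su : 0 < slack c u.
  rewrite lt_neqAle cP andbT eq_sym; apply: contraTneq uP => s0.
  by rewrite s0 (slack_t _ s0) ltxx.
have den : 0 < slack e u - slack c u by rewrite subr_gt0.
have tE : F u * (slack c u - slack e u) = - slack c u.
  by rewrite /F -(opprB (slack e u)) mulrN divfK // gt_eqF.
exists (F u); first by rewrite divr_gt0.
split=> [u'|].
  rewrite slackD; have [u'P|u'P] := ltP (slack c u') (slack e u').
    have := umin _ u'P; rewrite {2}/F ler_pdivlMr ?subr_gt0 //.
    by lra.
  by rewrite addr_ge0 ?cP // mulr_ge0 ?subr_ge0 // divr_ge0 // ltW.
rewrite /loose; apply: proper_card; apply/properP; split.
  apply/subsetP=> u'; rewrite !inE; apply: contraNneq => s0.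
  by rewrite slackD s0 (slack_t _ s0) subrr mulr0 addr0.
by exists u; rewrite inE ?slackD ?tE ?subrr ?eqxx // gt_eqF.
Qed.

(** The part of the support not reachable from [j] is separated from the component of [j], so
    [supp_feasible] shows it to be empty. *)
Lemma rsupp_connected (c : 'rV[R]_n) : feasible c -> c != 0 ->
  {in rsupp c &, forall i k, connect
    [rel x y | [&& x \in rsupp c, y \in rsupp c & (x != y) && (C x y != 0)]] i k}.
Proof.
move=> cP cn0; set e := [rel x y | _].
have e_sym : connect_sym e.
  apply: sym_connect_sym => x y /=; rewrite andbCA eq_sym; congr [&& _, _ & _ && ~~ _].
  by apply/eqP/eqP; apply: C_zero_sym.
have jJ := rsupp_j cP cn0.
have conj_j k : k \in rsupp c -> connect e j k.
  move=> kJ; apply/negPn/negP => njk.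
  have /setP/(_ k) : rsupp c :\: [set k | connect e j k] = set0.
    apply: (supp_feasible cP) => [||i l]; rewrite ?subsetDl // !inE ?connect0 //.
    case/andP; rewrite negb_and negbK => iS ci /andP[jl cl].
    have ji : connect e j i by move: iS; rewrite ci orbF.
    apply/eqP/negPn/negP=> Cil; case/negP: (jl); apply: connect_trans (ji) (connect1 _).
    rewrite /= !inE ci cl Cil /= andbT.
    by apply: contraNneq jl => <-.
  by rewrite in_setD inE njk kJ inE.
by move=> i k iJ kJ; rewrite (connect_trans _ (conj_j k kJ)) // e_sym conj_j.
Qed.

(** The coordinate version of [subdiagram_sum], with unit vectors in place of simple roots. *)
Definition corner_row (I : {set 'I_n}) (jI : j \in I) : 'rV[R]_n :=
  \sum_(a < #|I|) invmx (mxsub enum_val enum_val C)^T a (enum_rank_in jI j) *: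
    delta_mx 0 (enum_val a).

Lemma extend_rowE (I : {set 'I_n}) (x : 'I_#|I| -> R) i :
  (\sum_a x a *: delta_mx 0 (enum_val a) : 'rV[R]_n) 0 i =
  \sum_a x a * (enum_val a == i)%:R.
Proof. by rewrite summxE; apply: eq_bigr => a _; rewrite !mxE eq_sym. Qed.

Lemma extend_row_notin (I : {set 'I_n}) (x : 'I_#|I| -> R) i : i \notin I ->
  (\sum_a x a *: delta_mx 0 (enum_val a) : 'rV[R]_n) 0 i = 0.
Proof.
move=> iI; rewrite extend_rowE big1 // => a _.
by case: eqP iI => [<-|_]; rewrite ?enum_valP ?mulr0.
Qed.

Lemma extend_row_val (I : {set 'I_n}) (x : 'I_#|I| -> R) b :
  (\sum_a x a *: delta_mx 0 (enum_val a) : 'rV[R]_n) 0 (enum_val b) = x b.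
Proof.
rewrite extend_rowE (bigD1 b) //= eqxx mulr1 big1 ?addr0 // => a ab.
by rewrite (inj_eq enum_val_inj) (negPf ab) mulr0.
Qed.

Lemma extend_row_mul (I : {set 'I_n}) (x : 'I_#|I| -> R) k :
  ((\sum_a x a *: delta_mx 0 (enum_val a) : 'rV[R]_n) *m C) 0 k =
  \sum_a x a * C (enum_val a) k.
Proof.
rewrite mulmx_suml summxE; apply: eq_bigr => a _.
by rewrite -scalemxAl -rowE !mxE.
Qed.

(** A vector killed by the submatrix, extended by zero, is isotropic for the definite form. *)
Lemma principal_submx_unit (I : {set 'I_n}) :
  mxsub (@enum_val _ (mem I)) enum_val C \in unitmx.
Proof.
rewrite -row_free_unit; apply: inj_row_free => y yM.
pose x := \sum_a y 0 a *: delta_mx 0 (enum_val a) : 'rV[R]_n.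
have x0 : x = 0.
  apply: (@supported_definite I) => [i|k kI]; first exact: extend_row_notin.
  rewrite -(enum_rankK_in kI kI) extend_row_mul.
  set b := enum_rank_in kI k.
  have /rowP/(_ b) := yM; rewrite !mxE => E.
  rewrite (_ : \sum_a _ = 0) ?mulr0 // -[RHS]E.
  by apply: eq_bigr => a _; rewrite mxE.
apply/rowP=> b; rewrite -(extend_row_val (fun a => y 0 a) b) -/x x0.
by rewrite !mxE.
Qed.

(** Coefficients multiply [C] as a row, hence the transpose: the equations on [I] are one column of
    the identity [M^T *m invmx M^T = 1] for the principal submatrix [M]. *)
Lemma corner_rowP (I : {set 'I_n}) (jI : j \in I) : corner I (corner_row jI).
Proof.
split=> [i|k kI]; first exact: extend_row_notin.
rewrite -(enum_rankK_in jI kI) extend_row_mul; set b := enum_rank_in jI k.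
have MM : (mxsub (@enum_val _ (mem I)) enum_val C)^T *m
    invmx (mxsub (@enum_val _ (mem I)) enum_val C)^T = 1%:M.
  by rewrite mulmxV // unitmx_tr principal_submx_unit.
have /matrixP/(_ b (enum_rank_in jI j)) := MM; rewrite mxE [RHS]mxE => E.
have -> : (j == enum_val b) = (b == enum_rank_in jI j).
  by rewrite -(inj_eq enum_val_inj) (enum_rankK_in jI jI) eq_sym.
rewrite -E; apply: eq_bigr => a _; rewrite mulrC; congr (_ * _).
by rewrite !mxE.
Qed.

(* The feasible region is generated, as a convex set, by 0 and the corners; the
   induction is on the number of constraints that are not tight. *)
Lemma feasible_ind (Q : 'rV[R]_n -> Prop) :
  Q 0 -> (forall (I : {set 'I_n}) (jI : j \in I), Q (corner_row jI)) ->
  (forall x y t, Q x -> Q y -> 0 <= t <= 1 -> Q (t *: x + (1 - t) *: y)) ->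
  forall c, feasible c -> Q c.
Proof.
move=> Q0 Qcorner Qconv c; have [m] := ubnP #|loose c|.
elim: m c => // m IH c cm cP; have [->//|cn0] := eqVneq c 0.
have jJ := rsupp_j cP cn0.
have [->|ce] := eqVneq c (corner_row jJ); first exact: Qcorner.
have [t t_gt0 [c'P c'm]] := feasible_push cP cn0 ce (corner_rowP jJ).
set e := corner_row jJ in c'P c'm *.
have Qc' : Q (c + t *: (c - e)) by apply: IH => //; apply: leq_trans c'm _.
have t1 : 1 + t != 0 by rewrite gt_eqF // addr_gt0.
(* [c] lies between the corner and the exit point, which has fewer loose constraints. *)
suff -> : c = (1 + t)^-1 *: (c + t *: (c - e)) + (1 - (1 + t)^-1) *: e.
  apply: Qconv => //; first exact: Qcorner.
  by rewrite invr_ge0 addr_ge0 ?(ltW t_gt0) //= invf_le1 ?addr_gt0 // lerDl ltW.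
by apply/rowP=> i; rewrite !mxE; field.
Qed.

End FeasibleRegion.

(** * Bilinearity of the pairing *)

Section Pairing.

Variables (R : comNzRingType) (n : nat).
Implicit Types x y : 'rV[R]_n.

Lemma pairingE x y : pairing x y = \sum_i x 0 i * y 0 i.
Proof. by rewrite /pairing mxE; apply: eq_bigr => i _; rewrite mxE. Qed.

Lemma pairingDl x x' y : pairing (x + x') y = pairing x y + pairing x' y.
Proof. by rewrite /pairing mulmxDl mxE. Qed.

Lemma pairingZl a x y : pairing (a *: x) y = a * pairing x y.
Proof. by rewrite /pairing -scalemxAl mxE. Qed.

Lemma pairingNl x y : pairing (- x) y = - pairing x y.
Proof. by rewrite -scaleN1r pairingZl mulN1r. Qed.

Lemma pairingBl x x' y : pairing (x - x') y = pairing x y - pairing x' y.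
Proof. by rewrite pairingDl pairingNl. Qed.

Lemma pairing_suml I (r : seq I) P (F : I -> 'rV[R]_n) y :
  pairing (\sum_(i <- r | P i) F i) y = \sum_(i <- r | P i) pairing (F i) y.
Proof. by rewrite /pairing mulmx_suml summxE. Qed.

Lemma pairingC x y : pairing x y = pairing y x.
Proof. by rewrite !pairingE; apply: eq_bigr => i _; rewrite mulrC. Qed.

Lemma pairingZr a x y : pairing x (a *: y) = a * pairing x y.
Proof. by rewrite pairingC pairingZl pairingC. Qed.

Lemma pairingBr x y y' : pairing x (y - y') = pairing x y - pairing x y'.
Proof. by rewrite ![pairing x _]pairingC pairingBl. Qed.

Lemma pairing_delta x i : pairing x (delta_mx 0 i) = x 0 i.
Proof.
rewrite pairingE (bigD1 i) //= !mxE !eqxx mulr1 big1 ?addr0 // => k ki.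
by rewrite mxE (negPf ki) andbF mulr0.
Qed.

End Pairing.

(** * Extension of scalars to the rationals *)

Section ToQ.

Variable n : nat.
Implicit Types x y : 'rV[int]_n.

Lemma toQB x y : toQ (x - y) = toQ x - toQ y.
Proof. exact: map_mxB. Qed.

Lemma toQZ a x : toQ (a *: x) = a%:~R *: toQ x.
Proof. exact: map_mxZ. Qed.

Lemma toQ_sum I (r : seq I) (F : I -> 'rV[int]_n) :
  toQ (\sum_(i <- r) F i) = \sum_(i <- r) toQ (F i).
Proof. exact: raddf_sum. Qed.

Lemma pairing_toQ x y : pairing (toQ x) (toQ y) = (pairing x y)%:~R.
Proof.
rewrite !pairingE rmorph_sum; apply: eq_bigr => i _.
by rewrite !mxE rmorphM.
Qed.

Lemma toQ_inj : injective (@toQ n).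
Proof.
move=> x y /rowP xy; apply/rowP=> i.
by have := xy i; rewrite !mxE => /intr_inj.
Qed.

End ToQ.

(** * The Weyl-invariant inner product *)

Section InvariantForm.

Variables (n : nat) (D : root_datum n).
Hypothesis D_sc : simply_connected D.
Implicit Types (a b : 'rV[int]_n) (x y : 'rV[rat]_n).

Local Notation coroots := (undup [seq coroot D c | c <- roots D]).

(** The canonical form attached to the coroots. Since the list [roots D] may repeat entries, [undup]
    is applied so that a reflection permutes the index list. *)
Definition iform x y : rat :=
  \sum_(f <- coroots) pairing x (toQ f) * pairing y (toQ f).

Lemma iformC x y : iform x y = iform y x.
Proof. by apply: eq_bigr => f _; rewrite mulrC. Qed.

Lemma iformDl x x' y : iform (x + x') y = iform x y + iform x' y.
Proof. by rewrite -big_split; apply: eq_bigr => f _; rewrite pairingDl mulrDl. Qed.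

Lemma iformZl t x y : iform (t *: x) y = t * iform x y.
Proof. by rewrite mulr_sumr; apply: eq_bigr => f _; rewrite pairingZl mulrA. Qed.

Lemma iformBl x x' y : iform (x - x') y = iform x y - iform x' y.
Proof. by rewrite -scaleN1r iformDl iformZl mulN1r. Qed.

Lemma iform0l y : iform 0 y = 0.
Proof. by rewrite -(scale0r 0) iformZl mul0r. Qed.

Lemma iform_suml I (r : seq I) (F : I -> 'rV[rat]_n) y :
  iform (\sum_(i <- r) F i) y = \sum_(i <- r) iform (F i) y.
Proof.
by elim/big_rec2: _ => [|i s x _ <-]; rewrite ?iform0l ?iformDl.
Qed.

(** The form is a sum of squares, so [x] pairs to zero with all coroots; these generate the
    cocharacter lattice, which contains the coordinate vectors. *)
Lemma iform_definite x : iform x x <= 0 -> x = 0.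
Proof.
move=> xx; have f0 f : f \in coroots -> pairing x (toQ f) = 0.
  move=> fL; have ge0 g : 0 <= pairing x (toQ g) * pairing x (toQ g).
    by rewrite -expr2 sqr_ge0.
  have : iform x x == 0 by rewrite eq_le xx sumr_ge0.
  rewrite psumr_eq0 // => /allP/(_ f fL) /=.
  by rewrite mulf_eq0 orbb => /eqP.
apply/rowP=> i; rewrite mxE -pairing_delta.
have -> : delta_mx 0 i = toQ (delta_mx 0 i : 'rV[int]_n).
  by apply/rowP=> k; rewrite !mxE rmorph_nat.
have [c ->] := D_sc (delta_mx 0 i).
rewrite pairingC toQ_sum pairing_suml big1 // => k _.
rewrite toQZ pairingZl pairingC f0 ?mulr0 // mem_undup.
by rewrite map_f // mem_nth.
Qed.

Lemma pairing_reflection a x f :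
  pairing (reflection D a x) (toQ f) =
  pairing x (toQ (f - pairing a f *: coroot D a)).
Proof.
rewrite /reflection toQB toQZ pairingBl pairingBr pairingZl pairingZr.
by rewrite pairing_toQ mulrC.
Qed.

(** The adjoint [phi] of the reflection is an involution permuting the coroots, so the sum is merely
    reindexed. *)
Lemma iform_reflection a x y : a \in roots D ->
  iform (reflection D a x) (reflection D a y) = iform x y.
Proof.
move=> aR; pose phi f := f - pairing a f *: coroot D a.
have phiK : involutive phi.
  move=> f; rewrite /phi pairingBr pairingZr root_coroot2 //.
  by apply/rowP=> i; rewrite !mxE; ring.
have phiL f : f \in coroots -> phi f \in coroots.
  by rewrite !mem_undup => /mapP[b bR ->]; apply: refl_coroot.
rewrite /iform [LHS](eq_bigr (fun f =>
    pairing x (toQ (phi f)) * pairing y (toQ (phi f)))); last first.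
  by move=> f _; rewrite !pairing_reflection.
rewrite -(big_map phi predT (fun f => pairing x (toQ f) * pairing y (toQ f))).
apply: perm_big; apply: uniq_perm; rewrite ?undup_uniq //.
  by rewrite (map_inj_uniq (inv_inj phiK)) undup_uniq.
move=> f; apply/mapP/idP => [[g gL ->]|fL]; first exact: phiL.
by exists (phi f); rewrite ?phiL.
Qed.

Lemma reflection_root a : a \in roots D -> reflection D a (toQ a) = - toQ a.
Proof.
move=> aR; rewrite /reflection pairing_toQ root_coroot2 //.
by rewrite scaler_nat mulr2n opprD addNKr.
Qed.

(** Invariance under the reflection in [a], which negates [a], yields the classical formula for the
    coroot as [2a / (a, a)]. *)
Lemma pairing_coroot a x : a \in roots D ->
  pairing x (toQ (coroot D a)) * iform (toQ a) (toQ a) = 2 * iform x (toQ a).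
Proof.
move=> aR; have := iform_reflection x (toQ a) aR.
rewrite reflection_root // iformC -scaleN1r iformZl iformC iformBl iformZl; lra.
Qed.

Lemma root_neq0 a : a \in roots D -> toQ a != 0.
Proof.
move=> aR; apply/eqP=> a0; have := pairing_toQ a (coroot D a).
by rewrite a0 root_coroot2 // pairingE big1 // => i _; rewrite mxE mul0r.
Qed.

Lemma root_form_gt0 a : a \in roots D -> 0 < iform (toQ a) (toQ a).
Proof. by move=> aR; rewrite ltNge; apply: contra (root_neq0 aR) => /iform_definite->. Qed.

Lemma reflectionK a : a \in roots D -> involutive (reflection D a).
Proof.
move=> aR x; rewrite /reflection pairingBl pairingZl pairing_toQ root_coroot2 //.
by apply/rowP=> i; rewrite !mxE; ring.
Qed.

Definition reflectionZ a b := b - pairing b (coroot D a) *: a.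

Lemma toQ_reflection a b : toQ (reflectionZ a b) = reflection D a (toQ b).
Proof. by rewrite toQB toQZ /reflection pairing_toQ. Qed.

(* The root datum axioms only say that the reflected coroot is a coroot; the
   invariant form identifies the root it belongs to. *)
Lemma pairing_reflection_coroot a b x : a \in roots D -> b \in roots D ->
  pairing x (toQ (coroot D (reflectionZ a b))) =
  pairing (reflection D a x) (toQ (coroot D b)).
Proof.
move=> aR bR; have abR : reflectionZ a b \in roots D by apply: refl_root.
have adj : iform x (reflection D a (toQ b)) = iform (reflection D a x) (toQ b).
  by rewrite -{1}(reflectionK aR x) iform_reflection.
have := pairing_coroot x abR.
rewrite !toQ_reflection iform_reflection // adj -(pairing_coroot _ bR).
by apply: mulIf; rewrite gt_eqF // root_form_gt0.
Qed.

End InvariantForm.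

(** * Simple reflections, the exchange condition and generation of the Weyl group *)

Section Base.

Variables (n : nat) (D : root_datum n) (alpha : 'I_n -> 'rV[int]_n).
Hypothesis D_sc : simply_connected D.
Hypothesis alpha_base : is_base D alpha.
Implicit Types (a b : 'rV[int]_n) (x y : 'rV[rat]_n) (s : seq 'I_n).

Lemma simple_root i : alpha i \in roots D.
Proof. by case: alpha_base. Qed.
Local Hint Resolve simple_root : core.

Definition positive b := exists c : 'I_n -> nat, b = \sum_i alpha i *+ c i.

Lemma positiveVnegative b : b \in roots D -> positive b \/ positive (- b).
Proof.
case: alpha_base => _ _ sgn /sgn[c [->|->]]; [left|right]; exists c => //.
by rewrite opprK.
Qed.

Lemma simple_comb_inj (c e : 'I_n -> int) :
  \sum_i c i *: alpha i = \sum_i e i *: alpha i -> c =1 e.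
Proof.
case: alpha_base => _ free _ ce i; apply/eqP; rewrite -subr_eq0; apply/eqP.
apply: (free (fun i => c i - e i)).
under eq_bigr do rewrite scalerBl.
by rewrite sumrB ce subrr.
Qed.

Lemma positiveE (c : 'I_n -> nat) :
  \sum_i alpha i *+ c i = \sum_i (c i)%:Z *: alpha i.
Proof. by apply: eq_bigr => i _; rewrite -natz scaler_nat. Qed.

Lemma positiveN b : b \in roots D -> positive b -> ~ positive (- b).
Proof.
move=> bR [c bc] [e be].
have := simple_comb_inj (c := fun i => (c i)%:Z) (e := fun i => - (e i)%:Z).
rewrite -positiveE -bc => /(_ _)ce.
have {}ce : (fun i => (c i)%:Z) =1 (fun i => - (e i)%:Z).
  apply: ce; rewrite -[LHS]opprK be positiveE -sumrN.
  by apply: eq_bigr => i _; rewrite scaleNr.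
have c0 i : c i = 0%N by have := ce i => /=; lia.
have := root_coroot2 bR; rewrite bc big1 => [|i _]; last by rewrite c0.
by rewrite pairingE big1 // => i _; rewrite mxE mul0r.
Qed.

Lemma simple_positive i : positive (alpha i).
Proof.
exists (fun k => (i == k) : nat); rewrite (bigD1 i) //= eqxx mulr1n.
by rewrite big1 ?addr0 // => k; rewrite eq_sym => /negPf->.
Qed.

Lemma simple_inj : injective alpha.
Proof.
move=> i k ik; have := @simple_comb_inj (fun l => (l == i)%:Z) (fun l => (l == k)%:Z).
have E m : \sum_l (l == m)%:Z *: alpha l = alpha m.
  rewrite (bigD1 m) //= eqxx scale1r big1 ?addr0 // => l /negPf->.
  exact: scale0r.
rewrite !E => /(_ ik i) /=; rewrite eqxx.
by case: eqP.
Qed.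

Lemma simple_reflectionE k (c : 'I_n -> int) :
  reflectionZ D (alpha k) (\sum_i c i *: alpha i) =
  \sum_i (c i - (pairing (\sum_i c i *: alpha i) (coroot D (alpha k))) *+ (i == k))
     *: alpha i.
Proof.
rewrite /reflectionZ; set p := pairing _ _.
under [RHS]eq_bigr do rewrite scalerBl.
rewrite sumrB; congr (_ - _); rewrite (bigD1 k) //= eqxx mulr1n big1 ?addr0 //.
by move=> i /negPf->; rewrite mulr0n scale0r.
Qed.

(** The integer pairing of [alpha k] with the coroot of its multiple, times [m], is 2. So [m]
    divides 2, and reducedness excludes [m = 2]. *)
Lemma multiple_of_simple k (m : nat) : alpha k *+ m \in roots D -> m = 1%N.
Proof.
move=> mR; have aR := simple_root k.
have := pairing_coroot (toQ (alpha k)) mR.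
have -> : toQ (alpha k *+ m) = m%:R *: toQ (alpha k).
  by rewrite -scaler_nat toQZ rmorph_nat.
rewrite pairing_toQ !(iformZl, iformC _ _ (_ *: _)) => E.
have kk := root_form_gt0 D_sc aR; set q := iform D _ _ in E kk.
have m0 : m != 0%N.
  apply: contraTneq mR => ->; apply/negP=> /root_neq0/eqP[].
  by apply/rowP=> i; rewrite !mxE.
have mR0 : m%:R != 0 :> rat by rewrite pnatr_eq0.
set p := pairing _ _ in E.
have pm : p * m%:Z = 2.
  apply: (@intr_inj rat); rewrite rmorphM /= -[m%:Z]natz rmorph_nat.
  apply: (mulIf (lt0r_neq0 kk)); apply: (mulIf mR0).
  by rewrite -[RHS]mulrA [q * _]mulrC -E; ring.
have : (m %| 2)%N by rewrite -[m]/(absz m) -[2%N]/(absz 2) -pm abszM dvdn_mull.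
move/(dvdn_leq (isT : 0 < 2)%N) => m2.
suff : m != 2%N by lia.
by apply: contraTneq mR => ->; rewrite -scaler_nat roots_reduced.
Qed.

(** As [b] is not a multiple of [alpha k], it has a positive coefficient at some [i != k]. The
    reflection leaves that coefficient unchanged, so the image cannot be negative. *)
Lemma reflection_positive b k : b \in roots D -> positive b -> b != alpha k ->
  positive (reflectionZ D (alpha k) b).
Proof.
move=> bR [c bc] bk.
have rR : reflectionZ D (alpha k) b \in roots D by apply: refl_root.
case: (positiveVnegative rR) => // -[e re].
have [i ik ci] : exists2 i, i != k & c i != 0%N.
  apply/exists_inP; apply: contraT; rewrite negb_exists_in => /forall_inP ck.
  case/negP: bk; have bE : b = alpha k *+ c k.
    by rewrite bc (bigD1 k) //= big1 ?addr0 // => i /ck; rewrite negbK => /eqP->.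
  by move: bR; rewrite bE => /multiple_of_simple->.
move: re; rewrite [in LHS]bc positiveE simple_reflectionE.
move/(congr1 -%R); rewrite opprK positiveE -sumrN.
under [RHS]eq_bigr do rewrite -scaleNr.
move/simple_comb_inj/(_ i); rewrite (negPf ik) mulr0n; lia.
Qed.

(** Weyl group elements are handled as words in the simple reflections; the head of the word acts
    last. *)
Definition wact s x := foldr (fun i => reflection D (alpha i)) x s.
Definition wactZ s b := foldr (fun i => reflectionZ D (alpha i)) b s.

Lemma wact_cat s s' x : wact (s ++ s') x = wact s (wact s' x).
Proof. exact: foldr_cat. Qed.

Lemma wactZ_root s b : b \in roots D -> wactZ s b \in roots D.
Proof. by move=> bR; elim: s => //= i s IH; apply: refl_root. Qed.

Lemma toQ_wactZ s b : toQ (wactZ s b) = wact s (toQ b).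
Proof. by elim: s => //= i s IH; rewrite toQ_reflection IH. Qed.

(** The matrix form makes the linearity of a word's action available; points are rows, so it
    multiplies on the right. *)
Definition reflection_mx a : 'M[rat]_n := 1%:M - (toQ (coroot D a))^T *m toQ a.

Lemma reflection_mxE a x : reflection D a x = x *m reflection_mx a.
Proof.
rewrite /reflection_mx mulmxBr mulmx1 mulmxA; congr (_ - _).
by rewrite [x *m _]mx11_scalar mul_scalar_mx.
Qed.

Lemma reflection_conj a b x : a \in roots D -> b \in roots D ->
  reflection D (reflectionZ D a b) x =
  reflection D a (reflection D b (reflection D a x)).
Proof.
move=> aR bR; rewrite {1}/reflection pairing_reflection_coroot // toQ_reflection.
rewrite {3}/reflection [RHS]reflection_mxE mulmxBl -scalemxAl -!reflection_mxE.
by rewrite reflectionK.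
Qed.

Definition wact_mx s : 'M[rat]_n :=
  foldr (fun i M => M *m reflection_mx (alpha i)) 1%:M s.

Lemma wact_mxE s x : wact s x = x *m wact_mx s.
Proof.
elim: s => /= [|i s IH]; first by rewrite mulmx1.
by rewrite reflection_mxE IH mulmxA.
Qed.

Lemma pairing_wactZ s b x : b \in roots D ->
  pairing (wact s x) (toQ (coroot D (wactZ s b))) = pairing x (toQ (coroot D b)).
Proof.
move=> bR; elim: s => //= i s IH.
by rewrite (pairing_reflection_coroot D_sc) ?wactZ_root // reflectionK.
Qed.

(** At the letter [k] where the image of [alpha i] first turns negative, counting from the right end
    of the word, the root being reflected must be [alpha k], by [reflection_positive]. *)
Lemma exchange s i : ~ positive (wactZ s (alpha i)) ->
  exists s1 k s2, s = s1 ++ k :: s2 /\ wactZ s2 (alpha i) = alpha k.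
Proof.
elim: s => [[]|k s IH /= npos]; first exact: simple_positive.
have bR := wactZ_root s (simple_root i).
case: (positiveVnegative bR) => [pos|neg].
  exists [::], k, s; split=> //; apply/eqP/negPn/negP=> ne.
  exact/npos/reflection_positive.
have [|s1 [k' [s2 [-> E]]]] := IH; first by move/(positiveN bR); apply.
by exists (k :: s1), k', s2.
Qed.

Definition simple_mx : 'M[rat]_n := \matrix_i toQ (alpha i).

Lemma simple_mx_unit : simple_mx \in unitmx.
Proof.
have E : simple_mx = map_mx intr (\matrix_i alpha i).
  by apply/matrixP=> i k; rewrite !mxE.
rewrite unitmxE E det_map_mx unitfE intr_eq0; apply/det0P=> -[v /eqP v0 vA].
apply: v0; apply/rowP=> i; rewrite mxE.
case: alpha_base => _ /(_ (fun i => v 0 i)) free _; apply: free.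
rewrite -[RHS]vA mulmx_sum_row; apply: eq_bigr => k _.
by rewrite rowK.
Qed.

Definition simple_coef x := x *m invmx simple_mx.

Lemma simple_coefK x : simple_coef x *m simple_mx = x.
Proof. by rewrite mulmxKV // simple_mx_unit. Qed.

Lemma simple_coef_mul c : simple_coef (c *m simple_mx) = c.
Proof. by rewrite /simple_coef mulmxK // simple_mx_unit. Qed.

Lemma simple_coefD x y : simple_coef (x + y) = simple_coef x + simple_coef y.
Proof. exact: mulmxDl. Qed.
Lemma simple_coefB x y : simple_coef (x - y) = simple_coef x - simple_coef y.
Proof. exact: mulmxBl. Qed.
Lemma simple_coefZ t x : simple_coef (t *: x) = t *: simple_coef x.
Proof. by rewrite /simple_coef scalemxAl. Qed.

Lemma row_simple_mx i : row i simple_mx = toQ (alpha i).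
Proof. exact: rowK. Qed.

Lemma simple_coef_root i : simple_coef (toQ (alpha i)) = delta_mx 0 i.
Proof. by rewrite -row_simple_mx rowE simple_coef_mul. Qed.

Lemma simple_coef_positive b i : positive b -> 0 <= simple_coef (toQ b) 0 i.
Proof.
case=> c ->; rewrite positiveE toQ_sum /simple_coef mulmx_suml summxE.
rewrite sumr_ge0 // => k _.
by rewrite toQZ [_ *m _]simple_coefZ simple_coef_root !mxE mulr_ge0 ?ler0z ?ler0n.
Qed.

(** Induction on the length. Removing the last letter [k] changes the image by a nonnegative
    multiple of [wactZ s (alpha k)]. If this root is positive, the bound improves; if negative, the
    exchange condition shortens the word. *)
Lemma wact_le s x i : dominant D alpha x -> 0 <= simple_coef (x - wact s x) 0 i.
Proof.
move=> xdom; have [m] := ubnP (size s); elim: m s => // m IH s.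
case/lastP: s => [_|s k]; first by rewrite subrr /simple_coef mul0mx mxE.
rewrite size_rcons ltnS => sm.
have kE : wact (rcons s k) x =
    wact s x - pairing x (toQ (coroot D (alpha k))) *: toQ (wactZ s (alpha k)).
  by rewrite -cats1 wact_cat /= !wact_mxE toQ_wactZ wact_mxE mulmxBl -scalemxAl.
case: (positiveVnegative (wactZ_root s (simple_root k))) => [pos|neg].
  rewrite kE opprB addrCA simple_coefD simple_coefZ mxE [X in X + _]mxE.
  by rewrite addr_ge0 ?IH // mulr_ge0 ?simple_coef_positive.
have [|s1 [l [s2 [sE lE]]]] := @exchange s k.
  by move/(positiveN (wactZ_root s (simple_root k))); apply.
(* Since [s2] carries [alpha k] to [alpha l], the reflection [l] after [s2] equals [s2] after the
   reflection [k], and the two copies of [k] cancel. *)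
have -> : wact (rcons s k) x = wact (s1 ++ s2) x.
  rewrite -cats1 sE -catA !wact_cat; congr (wact s1 _) => /=.
  rewrite {2}/reflection wact_mxE mulmxBl -scalemxAl -!wact_mxE -toQ_wactZ lE.
  rewrite /reflection pairingBl pairingZl pairing_toQ root_coroot2 //.
  rewrite -lE pairing_wactZ //.
  by apply/rowP=> o; rewrite !mxE; ring.
apply: IH; apply: leq_ltn_trans sm; rewrite sE !size_cat /=; lia.
Qed.

(** Induction on the height: a positive root that is not simple is lowered by a suitable simple
    reflection. *)
Lemma root_word b : b \in roots D -> exists s i, b = wactZ s (alpha i).
Proof.
have pos_case m (c : 'I_n -> nat) b' : b' = \sum_i alpha i *+ c i ->
    (\sum_i c i < m)%N -> b' \in roots D -> exists s i, b' = wactZ s (alpha i).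
  elim: m c b' => // m IH c b' bE cm bR.
  (* Otherwise [(b', b')], expanded along the simple roots, would be nonpositive. *)
  have [i ci bi] : exists2 i, (0 < c i)%N & 0 < iform D (toQ b') (toQ (alpha i)).
    apply/exists_inP; apply: contraLR (root_form_gt0 D_sc bR).
    rewrite negb_exists_in -leNgt => /forall_inP h.
    rewrite {1}bE positiveE toQ_sum iform_suml; apply: sumr_le0 => i _.
    rewrite toQZ iformZl; have [->|ci] := posnP (c i); first by rewrite mul0r.
    by rewrite mulr_ge0_le0 ?ler0z // iformC leNgt h.
  have pgt0 : 0 < pairing b' (coroot D (alpha i)).
    rewrite -(ltr0z rat) -pairing_toQ.
    rewrite -(pmulr_lgt0 _ (root_form_gt0 D_sc (simple_root i))).
    by rewrite pairing_coroot // mulr_gt0.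
  have [->|bni] := eqVneq b' (alpha i); first by exists [::], i.
  have [|e eE] := @reflection_positive b' i bR _ bni; first by exists c.
  have rR : reflectionZ D (alpha i) b' \in roots D by apply: refl_root.
  have eC k : (e k)%:Z = (c k)%:Z - pairing b' (coroot D (alpha i)) *+ (k == i).
    apply: (@simple_comb_inj (fun k => (e k)%:Z)
      (fun k => (c k)%:Z - pairing b' (coroot D (alpha i)) *+ (k == i))).
    by rewrite -positiveE -eE bE positiveE simple_reflectionE.
  have em : (\sum_i e i < m)%N.
    apply: leq_trans (_ : \sum_i c i <= m)%N => //.
    rewrite (bigD1 i) //= [X in (_ < X)%N](bigD1 i) //= -addSn leq_add //.
      by have := eC i; rewrite eqxx mulr1n; lia.
    by apply: leq_sum => k ki; have := eC k; rewrite (negPf ki) mulr0n; lia.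
  have [s [k sE]] := IH e _ eE em rR.
  exists (i :: s), k; apply: toQ_inj.
  by rewrite /= -sE !toQ_reflection reflectionK.
move=> bR; case: (positiveVnegative bR) => -[c cE].
  exact: pos_case cE (ltnSn _) bR.
have NbR : - b \in roots D.
  have := refl_root bR bR; rewrite root_coroot2 // (_ : 2 *: b = b *+ 2).
    by rewrite mulr2n opprD addNKr.
  exact: (scaler_nat 2 b).
(* For a negative root, take a word for [- b] and append the letter [i], which negates [alpha i]. *)
have [s [i sE]] := pos_case _ _ _ cE (ltnSn _) NbR.
exists (s ++ [:: i]), i; apply: toQ_inj.
rewrite toQ_wactZ wact_cat /= reflection_root // wact_mxE mulNmx -wact_mxE.
by rewrite -toQ_wactZ -sE /toQ map_mxN opprK.
Qed.

(** A reflection in a conjugate of [alpha i] is the conjugate reflection, and reversing a word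
    inverts it. *)
Lemma reflection_word b : b \in roots D ->
  exists s, forall x, reflection D b x = wact s x.
Proof.
move=> /root_word[s [i ->]]; exists (s ++ i :: rev s).
elim: s => [|k s IH] x; first by [].
rewrite [wactZ _ _]/= reflection_conj ?wactZ_root // IH.
by rewrite rev_cons -cats1 -cat_cons catA [RHS]wact_cat.
Qed.

Lemma weyl_orbit_wact x y : weyl_orbit D x y -> exists s, y = wact s x.
Proof.
move=> [s sR ->]; elim: s sR => [|b s IH] sR; first by exists [::].
have [c cs|s' /= ->] := IH; first by rewrite sR // inE cs orbT.
have [t ->] := reflection_word (sR b (mem_head _ _)).
by exists (t ++ s'); rewrite wact_cat.
Qed.

Lemma wact_weyl_orbit s x : weyl_orbit D x (wact s x).
Proof.
exists (map alpha s); last by rewrite foldr_map.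
by move=> _ /mapP[i _ ->].
Qed.

End Base.

(** * The Cartan matrix satisfies the hypotheses on [C] *)

Section CartanMatrix.

Variables (n : nat) (D : root_datum n) (alpha : 'I_n -> 'rV[int]_n).
Hypothesis D_sc : simply_connected D.
Hypothesis alpha_base : is_base D alpha.
Local Notation A := (simple_mx alpha).
Local Notation C := (cartan D alpha).
Implicit Types (x y : 'rV[rat]_n).

Lemma mul_simple_mx x : x *m A = \sum_i x 0 i *: toQ (alpha i).
Proof. by rewrite mulmx_sum_row; apply: eq_bigr => i _; rewrite row_simple_mx. Qed.

Lemma mul_cartan x k : (x *m C) 0 k = pairing (x *m A) (toQ (coroot D (alpha k))).
Proof.
rewrite mul_simple_mx pairing_suml mxE; apply: eq_bigr => i _.
by rewrite pairingZl mxE.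
Qed.

Definition half_norm k : rat := iform D (toQ (alpha k)) (toQ (alpha k)) / 2.

Lemma half_norm_gt0 k : 0 < half_norm k.
Proof. by rewrite divr_gt0 // root_form_gt0 // simple_root. Qed.

(** By [pairing_coroot], [half_norm k] turns the pairing with the coroot of [alpha k] into the form
    with [alpha k], so the sum is the invariant form at [x *m A]. *)
Lemma cartan_definite x :
  \sum_k half_norm k * (x 0 k * (x *m C) 0 k) <= 0 -> x = 0.
Proof.
suff -> : \sum_k half_norm k * (x 0 k * (x *m C) 0 k) = iform D (x *m A) (x *m A).
  move/(iform_definite D_sc)=> xA.
  by rewrite -(simple_coef_mul alpha_base x) xA /simple_coef mul0mx.
rewrite {2}mul_simple_mx iformC iform_suml; apply: eq_bigr => k _.
rewrite iformZl [iform D _ (x *m A)]iformC mul_cartan /half_norm.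
have /esym/(canRL (mulKf _))-> // :=
  pairing_coroot (x *m A) (simple_root alpha_base k).
ring.
Qed.

(** The reflection in [alpha k] sends [alpha i] to a positive root whose coefficient at [alpha k] is
    [- C i k]. *)
Lemma cartan_offdiag i k : i != k -> C i k <= 0.
Proof.
move=> ik; have := reflection_positive D_sc alpha_base (simple_root alpha_base i)
  (simple_positive alpha i) (k := k).
rewrite (inj_eq (simple_inj alpha_base)) => /(_ ik)/(simple_coef_positive alpha_base k).
rewrite toQ_reflection /reflection simple_coefB simple_coefZ.
rewrite !(simple_coef_root alpha_base).
by rewrite !mxE !eqxx [k == i]eq_sym (negPf ik) mulr1 sub0r oppr_ge0.
Qed.

Lemma cartan_zero_sym i k : C i k = 0 -> C k i = 0.
Proof.
rewrite !mxE => ik; have iR := simple_root alpha_base i.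
have := pairing_coroot (toQ (alpha i)) (simple_root alpha_base k).
have := pairing_coroot (toQ (alpha k)) iR.
rewrite iformC => E1; rewrite ik mul0r -E1 => /esym/eqP.
by rewrite mulf_eq0 [iform _ _ _ == 0]gt_eqF ?root_form_gt0 // orbF => /eqP.
Qed.

End CartanMatrix.

(** * Averages over parabolic subgroups *)

Section ParabolicAverage.

Variables (n : nat) (D : root_datum n) (alpha : 'I_n -> 'rV[int]_n).
Hypothesis D_sc : simply_connected D.
Hypothesis alpha_base : is_base D alpha.
Local Notation A := (simple_mx alpha).
Local Notation T := (seq_sub (roots D)).
Implicit Types (x y : 'rV[rat]_n) (p : {perm T}).

Lemma simple_reflection_subproof i (t : T) :
  reflectionZ D (alpha i) (val t) \in roots D.
Proof. exact: refl_root (simple_root alpha_base i) (valP t). Qed.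

Definition simple_reflection i (t : T) : T := SeqSub (simple_reflection_subproof i t).

Lemma simple_reflectionK i : involutive (simple_reflection i).
Proof.
move=> t; apply: val_inj; apply: toQ_inj.
by rewrite /= !toQ_reflection reflectionK // simple_root.
Qed.

Definition simple_perm i : {perm T} := perm (inv_inj (simple_reflectionK i)).

(** The subgroup [W_I] is realised by permutations of the finite set of roots, which makes it a
    finite group to sum over. *)
Definition parabolic (I : {set 'I_n}) : {group {perm T}} :=
  <<[set simple_perm i | i in I]>>%G.

Lemma parabolic_word (I : {set 'I_n}) p : p \in parabolic I ->
  exists2 s : seq 'I_n, {subset s <= I} &
    forall t, val (p t) = wactZ D alpha s (val t).
Proof.
move=> /gen_prodgP[m [c cI ->]]; elim: m c cI => [|m IH] c cI.
  by exists [::] => // t; rewrite big_ord0 perm1.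
have [|s sI sE] := IH (fun k => c (widen_ord (leqnSn m) k)) => //.
have /imsetP[i iI ci] := cI ord_max.
exists (i :: s) => [k|t]; first by rewrite inE => /orP[/eqP->|/sI].
by rewrite big_ord_recr /= permM ci permE /= sE.
Qed.

Definition simple_sub i : T := SeqSub (simple_root alpha_base i).

(** The linear map determined by the images of the simple roots; no word has to be chosen for
    [p]. *)
Definition perm_mx_of p : 'M[rat]_n :=
  invmx A *m \matrix_i toQ (val (p (simple_sub i))).

Lemma perm_mx_ofE p s : (forall t, val (p t) = wactZ D alpha s (val t)) ->
  perm_mx_of p = wact_mx D alpha s.
Proof.
move=> ps; rewrite -[RHS](mulKmx (simple_mx_unit alpha_base)).
congr (_ *m _); apply/row_matrixP=> i.
by rewrite rowK ps toQ_wactZ wact_mxE row_mul row_simple_mx.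
Qed.

Definition parabolic_mean (I : {set 'I_n}) x : 'rV[rat]_n :=
  \sum_(p in parabolic I) #|parabolic I|%:R^-1 *: (x *m perm_mx_of p).

Lemma parabolic_mean_hull (I : {set 'I_n}) x :
  conv_hull (weyl_orbit D x) (parabolic_mean I x).
Proof.
exists #|parabolic I|, (fun k => x *m perm_mx_of (enum_val k)).
exists (fun=> #|parabolic I|%:R^-1); split.
- move=> k; have [s _ /perm_mx_ofE->] := parabolic_word (enum_valP k).
  by rewrite -wact_mxE; apply: wact_weyl_orbit.
- by move=> k; rewrite invr_ge0 ler0n.
- rewrite sumr_const card_ord -[_ *+ _]mulr_natl mulfV // pnatr_eq0.
  by rewrite -lt0n cardG_gt0.
by rewrite /parabolic_mean big_enum_val.
Qed.

(** Applying the reflection reindexes the sum by right translation in the group. *)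
Lemma parabolic_mean_fixed (I : {set 'I_n}) x i : i \in I ->
  reflection D (alpha i) (parabolic_mean I x) = parabolic_mean I x.
Proof.
move=> iI; have gi : simple_perm i \in parabolic I by apply/mem_gen/imset_f.
rewrite reflection_mxE mulmx_suml.
rewrite [RHS](reindex_inj (mulIg (simple_perm i))) /=; apply: eq_big => p.
  by rewrite groupMr.
move=> /parabolic_word[s _ sE]; rewrite -scalemxAl -mulmxA; congr (_ *: (_ *m _)).
rewrite (perm_mx_ofE sE) (@perm_mx_ofE (p * simple_perm i)%g (i :: s)) // => t.
by rewrite permM permE /= sE.
Qed.

Lemma pairing_parabolic_mean (I : {set 'I_n}) x i : i \in I ->
  pairing (parabolic_mean I x) (toQ (coroot D (alpha i))) = 0.
Proof.
move/(parabolic_mean_fixed x); rewrite /reflection => /eqP.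
rewrite -subr_eq0 addrAC subrr sub0r oppr_eq0 scaler_eq0.
by rewrite (negPf (root_neq0 (simple_root alpha_base i))) orbF => /eqP.
Qed.

Lemma simple_coef_wact s x i : i \notin s ->
  simple_coef alpha (x - wact D alpha s x) 0 i = 0.
Proof.
elim: s => [_|k s IH /=]; first by rewrite subrr /simple_coef mul0mx mxE.
rewrite inE negb_or => /andP[ik /IH E].
rewrite {1}/reflection opprB addrCA simple_coefD simple_coefZ.
rewrite (simple_coef_root alpha_base) mxE [X in X + _]mxE.
by rewrite E mxE (negPf ik) andbF mulr0 addr0.
Qed.

Lemma simple_coef_parabolic_mean (I : {set 'I_n}) x i : i \notin I ->
  simple_coef alpha (x - parabolic_mean I x) 0 i = 0.
Proof.
move=> iI; have card0 : #|parabolic I|%:R != 0 :> rat.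
  by rewrite pnatr_eq0 -lt0n cardG_gt0.
have -> : x - parabolic_mean I x =
    \sum_(p in parabolic I) #|parabolic I|%:R^-1 *: (x - x *m perm_mx_of p).
  under eq_bigr do rewrite scalerBr.
  rewrite sumrB -scaler_suml sumr_const -[_ *+ _]mulr_natl mulfV //.
  by rewrite scale1r.
rewrite /simple_coef mulmx_suml summxE big1 // => p.
move=> /parabolic_word[s sI /perm_mx_ofE->].
rewrite -wact_mxE -scalemxAl mxE [X in _ * X]simple_coef_wact ?mulr0 //.
by apply: contra iI => /sI.
Qed.

End ParabolicAverage.

(** * Convex hulls *)

Lemma conv_hull_incl n (S : 'rV[rat]_n -> Prop) x : S x -> conv_hull S x.
Proof.
move=> Sx; exists 1%N, (fun=> x), (fun=> 1).
by split=> //; rewrite big_ord1 ?scale1r.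
Qed.

Lemma conv_hull_convex n (S : 'rV[rat]_n -> Prop) x y t :
  conv_hull S x -> conv_hull S y -> 0 <= t <= 1 ->
  conv_hull S (t *: x + (1 - t) *: y).
Proof.
move=> [k [p [a [pS a0 a1 ->]]]] [l [q [b [qS b0 b1 ->]]]] /andP[t0 t1].
have s0 : 0 <= 1 - t by rewrite subr_ge0.
exists (k + l)%N, (fun i => match split i with inl u => p u | inr u => q u end).
exists (fun i => match split i with inl u => t * a u | inr u => (1 - t) * b u end).
have splitL u : split (lshift l u) = inl u.
  by rewrite -[lshift l u]/(unsplit (inl u)) unsplitK.
have splitR u : split (rshift k u) = inr u.
  by rewrite -[rshift k u]/(unsplit (inr u)) unsplitK.
split.
- by move=> i; case: (split i).
- by move=> i; case: (split i) => u; rewrite mulr_ge0.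
- rewrite big_split_ord /=.
  under eq_bigr do rewrite splitL; under [X in _ + X]eq_bigr do rewrite splitR.
  by rewrite -!mulr_sumr a1 b1; ring.
rewrite big_split_ord /= !scaler_sumr; congr (_ + _); apply: eq_bigr => u _.
  by rewrite splitL scalerA.
by rewrite splitR scalerA.
Qed.

(** * The polytope as the feasible region, and its vertices *)

Section FundamentalPolytope.

Variables (n : nat) (D : root_datum n) (alpha varpi : 'I_n -> 'rV[int]_n).
Variable j : 'I_n.
Hypothesis D_sc : simply_connected D.
Hypothesis alpha_base : is_base D alpha.
Hypothesis varpi_fund : is_fundamental_weights D alpha varpi.
Local Notation A := (simple_mx alpha).
Local Notation C := (cartan D alpha).
Local Notation lam := (toQ (varpi j)).
Local Notation IP := (intersection_polytope D alpha lam).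

Let definite := cartan_definite D_sc alpha_base.
Let norm_gt0 := half_norm_gt0 D_sc alpha_base.
Let offdiag := cartan_offdiag D_sc alpha_base.
Let zero_sym := cartan_zero_sym D_sc alpha_base.

Definition weight_below (c : 'rV[rat]_n) := lam - c *m A.

Lemma simple_coef_below c : simple_coef alpha (lam - weight_below c) = c.
Proof. by rewrite opprB addrC subrK (simple_coef_mul alpha_base). Qed.

Lemma below_simple_coef v : weight_below (simple_coef alpha (lam - v)) = v.
Proof. by rewrite /weight_below (simple_coefK alpha_base) opprB addrC subrK. Qed.

Lemma pairing_below c k :
  pairing (weight_below c) (toQ (coroot D (alpha k))) = (j == k)%:R - (c *m C) 0 k.
Proof. by rewrite pairingBl pairing_toQ varpi_fund rmorph_nat mul_cartan. Qed.

Lemma varpi_dominant : dominant D alpha lam.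
Proof. by move=> k; rewrite pairing_toQ varpi_fund ler0z. Qed.

Lemma subdiagram_sumE (I : {set 'I_n}) (jI : j \in I) :
  subdiagram_sum D alpha jI = corner_row C jI *m A.
Proof.
rewrite mulmx_suml; apply: eq_bigr => a _.
by rewrite -scalemxAl -rowE row_simple_mx.
Qed.

(** Nonnegativity of the coefficients comes from [wact_le], averaged over the convex combination;
    the other constraints are dominance. *)
Lemma polytope_feasible v : IP v -> feasible C j (simple_coef alpha (lam - v)).
Proof.
move=> [[m [p [t [pW t0 t1 ->]]]] vdom] [i|k] /=; last first.
  by rewrite -pairing_below below_simple_coef.
have -> : lam - \sum_k t k *: p k = \sum_k t k *: (lam - p k).
  by under [RHS]eq_bigr do rewrite scalerBr; rewrite sumrB -scaler_suml t1 scale1r.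
rewrite /simple_coef mulmx_suml summxE sumr_ge0 // => k _.
rewrite -scalemxAl mxE mulr_ge0 //.
have [s ->] := weyl_orbit_wact D_sc alpha_base (pW k).
exact: (wact_le D_sc alpha_base) varpi_dominant.
Qed.

(** The mean is orthogonal to the coroots in [I] and differs from [lam] only along the simple roots
    in [I]. These are the corner equations, whose solution is unique. *)
Lemma corner_mean (I : {set 'I_n}) (jI : j \in I) :
  weight_below (corner_row C jI) = parabolic_mean alpha_base I lam.
Proof.
have cI : corner C j I (simple_coef alpha (lam - parabolic_mean alpha_base I lam)).
  split=> [i iI|k kI]; first exact: simple_coef_parabolic_mean.
  apply/esym/eqP; rewrite -subr_eq0 -pairing_below below_simple_coef.
  by rewrite pairing_parabolic_mean.
rewrite (corner_inj definite norm_gt0 (corner_rowP definite norm_gt0 jI) cI).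
exact: below_simple_coef.
Qed.

Lemma feasible_polytope c : feasible C j c -> IP (weight_below c).
Proof.
move=> cP; split; last first.
  by move=> k; rewrite pairing_below; apply: (cP (inr k)).
move: c cP; apply: (feasible_ind definite norm_gt0 offdiag).
- rewrite /weight_below mul0mx subr0; apply: conv_hull_incl.
  by exists [::].
- by move=> I jI; rewrite corner_mean; apply: parabolic_mean_hull.
move=> x y t xH yH tI.
rewrite (_ : weight_below _ = t *: weight_below x + (1 - t) *: weight_below y).
  exact: conv_hull_convex.
rewrite /weight_below mulmxDl -!scalemxAl.
by apply/rowP=> i; rewrite !mxE; ring.
Qed.

(** A constraint tight at an interior point of a segment in the region is tight at both ends, and
    the constraints tight at a corner determine it. *)
Lemma corner_vertex (I : {set 'I_n}) c :
  corner C j I c -> vertex IP (weight_below c).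
Proof.
move=> cI; split.
  exact: feasible_polytope (corner_feasible definite norm_gt0 offdiag cI).
move=> x y t /polytope_feasible xP /polytope_feasible yP /andP[t0 t1] cE.
set cx := simple_coef alpha (lam - x) in xP.
set cy := simple_coef alpha (lam - y) in yP.
have cxy : c = t *: cx + (1 - t) *: cy.
  rewrite -[LHS]simple_coef_below cE -!simple_coefZ -simple_coefD.
  by congr (simple_coef _ _); apply/rowP=> i; rewrite !mxE; ring.
have slackE u : slack C j c u = t * slack C j cx u + (1 - t) * slack C j cy u.
  case: u => [i|k] /=; first by rewrite cxy !mxE.
  rewrite cxy mulmxDl -!scalemxAl ![(_ + _ : 'rV_n) 0 k]mxE.
  by rewrite ![(_ *: _ : 'rV_n) 0 k]mxE; ring.
have tight u : slack C j c u = 0 -> slack C j cx u = 0 /\ slack C j cy u = 0.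
  rewrite slackE => /eqP.
  rewrite paddr_eq0 ?mulr_ge0 ?xP ?yP ?ltW ?subr_gt0 //.
  rewrite !mulf_eq0 [t == 0]gt_eqF // [1 - t == 0]gt_eqF ?subr_gt0 //=.
  by case/andP=> /eqP-> /eqP->.
have cornerE e : (forall u, slack C j c u = 0 -> slack C j e u = 0) -> e = c.
  move=> eT; apply: (corner_inj definite norm_gt0 _ cI).
  case: cI => c0 cC; split=> [i iI|k kI]; first exact/(eT (inl i))/c0.
  by apply/esym/eqP; rewrite -subr_eq0; apply/eqP/(eT (inr k)); rewrite /= cC ?subrr.
rewrite -[x]below_simple_coef -[y]below_simple_coef -/cx -/cy.
by split; congr weight_below; apply: cornerE => u /tight[].
Qed.

Lemma vertex_corner v : vertex IP v -> v = lam \/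
  exists (I : {set 'I_n}) (jI : j \in I),
    connected_subdiagram D alpha I /\ v = weight_below (corner_row C jI).
Proof.
move=> [vP vext]; set c := simple_coef alpha (lam - v).
have cP : feasible C j c := polytope_feasible vP.
have vE : v = weight_below c by rewrite below_simple_coef.
have [c0|cn0] := eqVneq c 0.
  by left; rewrite vE c0 /weight_below mul0mx subr0.
right; have jJ := rsupp_j definite norm_gt0 cP cn0.
exists (rsupp c), jJ; split.
  apply/andP; split; first by apply/set0Pn; exists j.
  apply/forall_inP=> i iJ; apply/forall_inP=> k kJ.
  exact: (rsupp_connected definite norm_gt0 zero_sym cP).
set e := corner_row C jJ.
have eI : corner C j (rsupp c) e := corner_rowP definite norm_gt0 jJ.
have [ce|ce] := eqVneq c e; first by rewrite vE ce.
have [t t0 [c'P _]] := feasible_push definite norm_gt0 offdiag cP cn0 ce eI.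
have eP := corner_feasible definite norm_gt0 offdiag eI.
have s0 : 0 < 1 + t by rewrite addr_gt0.
(* [v] is a proper convex combination of the pushed point and the corner, so extremality identifies
   it with the corner. *)
have [| |_ <-//] :=
  vext _ _ (1 + t)^-1 (feasible_polytope c'P) (feasible_polytope eP).
  by rewrite invr_gt0 s0 invf_lt1 // ltrDl.
rewrite vE /weight_below mulmxDl -scalemxAl mulmxBl.
by apply/rowP=> i; rewrite !mxE; field; rewrite gt_eqF.
Qed.

End FundamentalPolytope.

Theorem theorem1p2 (r : nat) (D : root_datum r)
    (D_simple : simple_datum D) (D_sc : simply_connected D)
    (alpha : 'I_r -> 'rV[int]_r) (alpha_base : is_base D alpha)
    (varpi : 'I_r -> 'rV[int]_r)
    (varpi_fund : is_fundamental_weights D alpha varpi)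
    (j : 'I_r) (v : 'rV[rat]_r) :
  vertex (intersection_polytope D alpha (toQ (varpi j))) v <->
    v = toQ (varpi j) \/
    exists (I : {set 'I_r}) (jI : j \in I),
      connected_subdiagram D alpha I /\
      v = toQ (varpi j) - subdiagram_sum D alpha jI.
Proof.
split=> [/(vertex_corner D_sc alpha_base varpi_fund)[->|]|[->|]]; first by left.
- move=> [I [jI [Iconn ->]]]; right; exists I, jI.
  by rewrite subdiagram_sumE.
(* The vertex [varpi_j] is the corner of the empty set. *)
- have zero_corner : corner (cartan D alpha) j set0 0.
    by split=> [i _|k]; rewrite ?mxE ?inE.
  have := corner_vertex D_sc alpha_base varpi_fund zero_corner.
  by rewrite /weight_below mul0mx subr0.
move=> [I [jI [_ ->]]]; rewrite subdiagram_sumE.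
apply: (corner_vertex D_sc alpha_base varpi_fund).
exact: (corner_rowP (cartan_definite D_sc alpha_base)
  (half_norm_gt0 D_sc alpha_base)).
Qed.
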